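(* Let $\mathfrak{g}$ be a simple, simply-laced Lie algebra of rank $r$ with Cartan matrix $C$, let $k\in\mathbb{Z}$, and let $(\mathbf{x},B)$ be the seed at node $k$, i.e. $$\mathbf{x}=(\widetilde{Q}_{1,2k},\dots,\widetilde{Q}_{r,2k},\widetilde{Q}_{1,2k+1},\dots,\widetilde{Q}_{r,2k+1}),\qquad B=\begin{pmatrix}0&-C\\ C&0\end{pmatrix}.$$ Then the seed corresponding to the node $(k-1)'$, which is by definition $(\mathbf{x}',B')=\mu_{2r}\circ\cdots\circ\mu_{r+1}(\mathbf{x},B)$, is given by $$\mathbf{x}'=(\widetilde{Q}_{1,2k},\dots,\widetilde{Q}_{r,2k},\widetilde{Q}_{1,2k-1},\dots,\widetilde{Q}_{r,2k-1}),\qquad B'=\begin{pmatrix}0&C\\ -C&0\end{pmatrix}.$$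
   Context: Let $I_r=\{1,\dots,r\}$ be the set of nodes of the Dynkin diagram of $\mathfrak{g}$; $\beta\sim\alpha$ means $\beta,\alpha$ are distinct adjacent nodes. The variables $\widetilde{Q}_{\alpha,k}$ ($\alpha\in I_r$, $k\in\mathbb{Z}$) are elements of the field of rational functions over $\mathbb{C}$ in the $2r$ algebraically independent indeterminates $\widetilde{Q}_{\alpha,0},\widetilde{Q}_{\alpha,1}$, determined (in both directions of $k$) by the normalized $Q$-system $$\widetilde{Q}_{\alpha,k+1}\,\widetilde{Q}_{\alpha,k-1}=\widetilde{Q}_{\alpha,k}^2+\prod_{\beta\sim\alpha}\widetilde{Q}_{\beta,k}\qquad(\alpha\in I_r,\ k\in\mathbb{Z}).$$ A seed of rank $n=2r$ is a pair $(\mathbf{x},B)$ with $\mathbf{x}=(x_1,\dots,x_n)$ a vector of cluster variables and $B$ a skew-symmetric $n\times n$ integer matrix. The mutation $\mu_m$ in direction $m\in\{1,\dots,n\}$ sends $(\mathbf{x},B)$ to the seed with $$\mu_m(x_i)=x_i\ (i\ne m),\qquad \mu_m(x_m)=x_m^{-1}\Bigl(\prod_{j=1}^n x_j^{[B_{jm}]_+}+\prod_{j=1}^n x_j^{[-B_{jm}]_+}\Bigr),$$ $$\mu_m(B_{ij})=-B_{ij}\ \text{if } i=m \text{ or } j=m,\qquad \mu_m(B_{ij})=B_{ij}+\mathrm{sign}(B_{im})\,[B_{im}B_{mj}]_+\ \text{otherwise},$$ where $[a]_+=\max(a,0)$. *)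

(* Defs.v *)
From HB Require Import structures.
From mathcomp Require Import all_boot all_order all_algebra.
From mathcomp Require Import mpoly complex reals.
Import Order.TTheory GRing.Theory Num.Theory.

Set Implicit Arguments.
Unset Strict Implicit.
Unset Printing Implicit Defensive.

Local Open Scope ring_scope.

(* Complex numbers are R[i] for R : realType (a realType is unique up to
   isomorphism). *)

Record lieAlgebra (K : fieldType) := LieAlgebra {
  lie_sort :> vectType K;
  lie_br : lie_sort -> lie_sort -> lie_sort;
  lie_brDl : forall (a : K) x y z,
    lie_br (a *: x + y) z = a *: lie_br x z + lie_br y z;
  lie_brDr : forall (a : K) x y z,
    lie_br x (a *: y + z) = a *: lie_br x y + lie_br x z;
  lie_brxx : forall x, lie_br x x = 0;
  lie_jacobi : forall x y z,
    lie_br x (lie_br y z) + lie_br y (lie_br z x) + lie_br z (lie_br x y) = 0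
}.

Section LieAlgebra.
Variables (K : fieldType) (g : lieAlgebra K).

Definition lie_ideal (I : {vspace g}) : Prop :=
  forall x y : g, y \in I -> lie_br x y \in I.

Definition lie_simple : Prop :=
  (exists x y : g, lie_br x y != 0) /\
  (forall I : {vspace g}, lie_ideal I -> I = 0%VS \/ I = fullv).

(* [U, V], the span of all brackets [u, v] *)
Definition lie_brv (U V : {vspace g}) : {vspace g} :=
  <<[seq lie_br u v | u <- vbasis U, v <- vbasis V]>>%VS.

Definition lie_nilpotent (H : {vspace g}) : Prop :=
  exists n, iter n (lie_brv H) H = 0%VS.

Definition cartan_subalgebra (H : {vspace g}) : Prop :=
  [/\ forall x y : g, x \in H -> y \in H -> lie_br x y \in H,
      lie_nilpotent H
    & forall x : g, (forall h, h \in H -> lie_br x h \in H) -> x \in H].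

Definition lie_dual (H : {vspace g}) := 'Hom(subvs_of H, K^o).

Definition in_root_space (H : {vspace g}) (a : lie_dual H) (x : g) : Prop :=
  forall h : subvs_of H, lie_br (vsval h) x = (a h : K) *: x.

Definition is_root (H : {vspace g}) (a : lie_dual H) : Prop :=
  a != 0 /\ exists2 x : g, x != 0 & in_root_space a x.

Definition simple_roots (H : {vspace g}) (r : nat) (a : 'I_r -> lie_dual H) :
    Prop :=
  [/\ forall i, is_root (a i),
      basis_of fullv [seq a i | i <- enum 'I_r]
    & forall b : lie_dual H, is_root b ->
      exists c : 'I_r -> nat,
        b = \sum_i a i *+ c i \/ b = - \sum_i a i *+ c i].

Definition is_coroot (H : {vspace g}) (a : lie_dual H) (h : subvs_of H) :
    Prop :=
  (exists x y : g,
    [/\ in_root_space a x, in_root_space (- a) y & vsval h = lie_br x y]) /\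
  a h = 2%:R :> K.

(* g has rank r = dim H, and C i j = <a_j, a_i^vee> for a system a of simple
   roots relative to some Cartan subalgebra H. *)
Definition cartan_matrix (r : nat) (C : 'M[int]_r) : Prop :=
  exists (H : {vspace g}) (a : 'I_r -> lie_dual H) (hv : 'I_r -> subvs_of H),
    [/\ cartan_subalgebra H, \dim H = r, simple_roots a,
        forall i, is_coroot (a i) (hv i)
      & forall i j, a j (hv i) = (C i j)%:~R :> K].

End LieAlgebra.

(* Distinct nodes of the Dynkin diagram are either not joined, or joined by one
   unoriented edge. *)
Definition simply_laced (r : nat) (C : 'M[int]_r) : Prop :=
  forall i j : 'I_r, i != j ->
    (C i j = 0 /\ C j i = 0) \/ (C i j = -1 /\ C j i = -1).

Definition dynkin_adj (r : nat) (C : 'M[int]_r) : rel 'I_r :=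
  [rel b a | (b != a) && (C b a != 0)].

Definition pospart (a : int) : int := Num.max a 0.

Record seed (F : fieldType) (n : nat) := Seed {
  cluster : 'rV[F]_n;
  exchange : 'M[int]_n;
  exchange_skew : exchange^T = - exchange
}.

Section Mutation.
Variables (F : fieldType) (n : nat).

Definition mutate_cluster (m : 'I_n) (x : 'rV[F]_n) (B : 'M[int]_n) : 'rV[F]_n :=
  \row_i if i == m then
      (x 0 m)^-1 * (\prod_j x 0 j ^ pospart (B j m)
                    + \prod_j x 0 j ^ pospart (- B j m))
    else x 0 i.

Definition mutate_exchange (m : 'I_n) (B : 'M[int]_n) : 'M[int]_n :=
  \matrix_(i, j) if (i == m) || (j == m) then - B i j
    else B i j + sgz (B i m) * pospart (B i m * B m j).

Lemma mutate_exchange_skew (m : 'I_n) (B : 'M[int]_n) :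
  B^T = - B -> (mutate_exchange m B)^T = - mutate_exchange m B.
Proof.
move=> skB; have sk i j : B j i = - B i j.
  by have /matrixP/(_ i j) := skB; rewrite !mxE.
apply/matrixP => i j; rewrite !mxE orbC; case: ifP => _; first by rewrite sk.
rewrite (sk i j) opprD; congr (_ + _).
rewrite (sk m j) (sk i m) mulrNN [B m j * _]mulrC sgzN mulNr; congr (- _).
rewrite /pospart; case: leP => [_|]; first by rewrite !mulr0.
move=> Bpos; have : sgz (B i m * B m j) = 1 by apply: gtr0_sgz.
rewrite sgzM => e; congr (_ * _); move: e.
by case: sgzP => _; case: sgzP.
Qed.

Definition mutate (s : seed F n) (m : 'I_n) : seed F n :=
  @Seed F n (mutate_cluster m (cluster s) (exchange s)) _
    (mutate_exchange_skew m (exchange_skew s)).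

(* mutate_seq [:: m_1; ...; m_p] s = (mu_(m_p) o ... o mu_(m_1)) s *)
Definition mutate_seq (ms : seq 'I_n) (s : seed F n) : seed F n :=
  foldl mutate s ms.

End Mutation.

Section QSystem.
Variables (K : fieldType) (r : nat) (C : 'M[int]_r).

(* Rational functions in r + r indeterminates: 'X_(lshift r a) is Q_(a,0) and
   'X_(rshift r a) is Q_(a,1). *)
Definition Qfield : fieldType := {fraction {mpoly K[r + r]}}.

Definition Qsystem (Q : 'I_r -> int -> Qfield) : Prop :=
  [/\ forall a, Q a 0 = tofrac 'X_(lshift r a),
      forall a, Q a 1 = tofrac 'X_(rshift r a)
    & forall a (k : int),
      Q a (k + 1) * Q a (k - 1) =
        Q a k ^+ 2 + \prod_(b | dynkin_adj C b a) Q b k].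

End QSystem.

(* The Q-system has exactly one solution: the recursion never divides by zero,
   every Q_(a,k) being a quotient of polynomials which are positive at
   (1, ..., 1). *)
Section QSystemWellPosed.
Variables (K : numFieldType) (r : nat) (C : 'M[int]_r).
Local Notation F := (Qfield K r).

Definition at_ones (p : {mpoly K[r + r]}) : K := p.@[fun=> 1].

Definition Qpos (x : F) : Prop := exists p q : {mpoly K[r + r]},
  [/\ 0 < at_ones p, 0 < at_ones q & x = tofrac p / tofrac q].

Lemma at_ones_neq0 p : 0 < at_ones p -> tofrac p != 0 :> F.
Proof.
by move=> h; rewrite tofrac_eq0; apply: contraTneq h => ->;
  rewrite /at_ones meval0 ltxx.
Qed.

Lemma QposX i : Qpos (tofrac 'X_i).
Proof.
by exists 'X_i, 1; rewrite /at_ones mevalXU meval1 ltr01 rmorph1 divr1.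
Qed.

Lemma Qpos1 : Qpos 1.
Proof.
by exists 1, 1; rewrite /at_ones meval1 ltr01 rmorph1 divr1.
Qed.

Lemma QposM x y : Qpos x -> Qpos y -> Qpos (x * y).
Proof.
move=> [p [q [hp hq ->]]] [p' [q' [hp' hq' ->]]].
exists (p * p'), (q * q').
by rewrite /at_ones !mevalM !mulr_gt0// !rmorphM/= invfM mulrACA.
Qed.

Lemma QposD x y : Qpos x -> Qpos y -> Qpos (x + y).
Proof.
move=> [p [q [hp hq ->]]] [p' [q' [hp' hq' ->]]].
exists (p * q' + p' * q), (q * q').
rewrite /at_ones mevalD !mevalM addr_gt0 ?mulr_gt0//; split=> //.
by rewrite addf_div ?at_ones_neq0// rmorphD !rmorphM.
Qed.

Lemma QposV x : Qpos x -> Qpos x^-1.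
Proof. by move=> [p [q [hp hq ->]]]; exists q, p; rewrite invf_div. Qed.

Lemma Qpos_neq0 x : Qpos x -> x != 0.
Proof.
move=> [p [q [hp hq ->]]].
by rewrite mulf_neq0 ?invr_neq0 ?at_ones_neq0.
Qed.

Definition Qrhs (u : 'I_r -> F) (a : 'I_r) : F :=
  u a ^+ 2 + \prod_(b | dynkin_adj C b a) u b.

Definition Qstep (uv : ('I_r -> F) * ('I_r -> F)) :=
  (uv.2, fun a => Qrhs uv.2 a / uv.1 a).

Let X0 (a : 'I_r) : F := tofrac 'X_(lshift r a).
Let X1 (a : 'I_r) : F := tofrac 'X_(rshift r a).
Let fwd n := iter n Qstep (X0, X1).
Let bwd n := iter n Qstep (X1, X0).

Lemma Qstep_pos uv : (forall a, Qpos (uv.1 a)) /\ (forall a, Qpos (uv.2 a)) ->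
  (forall a, Qpos ((Qstep uv).1 a)) /\ (forall a, Qpos ((Qstep uv).2 a)).
Proof.
move=> [h1 h2]; split=> // a; rewrite /= /Qrhs.
apply: QposM (QposV (h1 a)); apply: QposD; first exact: QposM.
by elim/big_ind: _ => //; [exact: Qpos1 | exact: QposM].
Qed.

Let fwd_pos n : (forall a, Qpos ((fwd n).1 a)) /\ (forall a, Qpos ((fwd n).2 a)).
Proof.
by elim: n => [|n IH]; [split=> a; apply: QposX | exact: (Qstep_pos IH)].
Qed.

Let bwd_pos n : (forall a, Qpos ((bwd n).1 a)) /\ (forall a, Qpos ((bwd n).2 a)).
Proof.
by elim: n => [|n IH]; [split=> a; apply: QposX | exact: (Qstep_pos IH)].
Qed.

Let Qstep_mul uv a : (forall a, Qpos (uv.1 a)) ->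
  (Qstep uv).2 a * uv.1 a = Qrhs uv.2 a.
Proof. by move=> h; rewrite /= divfK// Qpos_neq0. Qed.

Let sol (a : 'I_r) (k : int) : F :=
  match k with Posz n => (fwd n).1 a | Negz n => (bwd n.+1).2 a end.

Lemma Qsystem_exists : exists Q : 'I_r -> int -> F, Qsystem C Q.
Proof.
exists sol; split=> // a k.
suff [uv [puv -> -> e]] : exists uv, [/\ forall b, Qpos (uv.1 b),
    sol a (k + 1) * sol a (k - 1) = (Qstep uv).2 a * uv.1 a,
    sol a k = uv.2 a & forall b, sol b k = uv.2 b].
  by rewrite Qstep_mul//; congr (_ + _); apply: eq_bigr => b _; rewrite e.
case: k => [[|n]|n].
- by exists (bwd 0); split=> //; [case: (bwd_pos 0) | rewrite mulrC].
- have e1 : Posz n.+1 + 1 = Posz n.+2 by rewrite -PoszD addn1.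
  have e2 : Posz n.+1 - 1 = Posz n by rewrite -addn1 PoszD addrK.
  by exists (fwd n); split=> //; [case: (fwd_pos n) | rewrite e1 e2].
- have e1 : Negz n + 1 = - Posz n by rewrite NegzE -addn1 PoszD opprD subrK.
  have e2 : Negz n - 1 = Negz n.+1.
    by rewrite !NegzE -(addn1 n.+1) PoszD opprD.
  have e3 : sol a (- Posz n) = (bwd n).2 a by case: n {e1 e2}.
  exists (bwd n.+1); split=> //; first by case: (bwd_pos n.+1).
  by rewrite e1 e2 e3 mulrC.
Qed.

Lemma Qsystem_unique (Q Q' : 'I_r -> int -> F) :
  Qsystem C Q -> Qsystem C Q' -> forall a k, Q a k = Q' a k.
Proof.
suff det P : Qsystem C P -> forall k a, P a k = sol a k.
  by move=> hQ hQ' a k; rewrite !det.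
move=> [P0 P1 PS].
have up (n : nat) : (forall a, P a (Posz n) = (fwd n).1 a) /\
    (forall a, P a (Posz n.+1) = (fwd n).2 a).
  elim: n => [|n [IH1 IH2]]; first by split=> a; [exact: P0 | exact: P1].
  split=> // a; have [pn _] := fwd_pos n.
  apply: (mulIf (Qpos_neq0 (pn a))).
  rewrite [RHS](@Qstep_mul (fwd n))//.
  have e1 : Posz n.+1 + 1 = Posz n.+2 by rewrite -PoszD addn1.
  have e2 : Posz n.+1 - 1 = Posz n by rewrite -addn1 PoszD addrK.
  have := PS a (Posz n.+1); rewrite e1 e2 IH1 IH2 => ->.
  by congr (_ + _); apply: eq_bigr => b _; rewrite IH2.
have dn (n : nat) : (forall a, P a (- Posz n + 1) = (bwd n).1 a) /\
    (forall a, P a (- Posz n) = (bwd n).2 a).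
  elim: n => [|n [IH1 IH2]].
    by split=> a; rewrite oppr0 ?add0r; [exact: P1 | exact: P0].
  have e : - Posz n.+1 = - Posz n - 1 by rewrite -addn1 PoszD opprD.
  split=> a; first by rewrite e subrK IH2.
  have [pn _] := bwd_pos n.
  apply: (mulIf (Qpos_neq0 (pn a))).
  rewrite [RHS](@Qstep_mul (bwd n))//.
  have := PS a (- Posz n); rewrite -e IH1 IH2 mulrC => ->.
  by congr (_ + _); apply: eq_bigr => b _; rewrite IH2.
by case=> n a; [exact: (up n).1 | rewrite NegzE; exact: (dn n.+1).2].
Qed.

End QSystemWellPosed.

(* Main.v *)
Require Import Defs.
From mathcomp Require Import all_boot all_order all_algebra.
From mathcomp Require Import mpoly complex reals.
Import Order.TTheory GRing.Theory Num.Theory.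
Local Open Scope ring_scope.

(** No arrow ever joins two of the nodes [r+1, ..., 2r] during the mutation
    sequence, so the column read at the mutation [r+a] is still the one of the
    initial matrix: its exchange relation is the [Q]-system relation at
    [(a, 2k)], solved for [Q_(a,2k-1)]. The upper left block collects one
    correction per mutation; in entry [(i, j)] with [i ~ j] only the mutations
    [r+i] and [r+j] contribute, by [-2] and [+2]. Dividing by [Q_(a,2k+1)] is
    legitimate because the [Q_(a,k)] are positive at [(1, ..., 1)]. *)

(** The coroot normalization gives 2 in [K]; characteristic zero brings the equality back to the
    integers. *)
Lemma cartan_matrix_diag (K : numFieldType) (g : lieAlgebra K) (r : nat)
    (C : 'M[int]_r) (i : 'I_r) : cartan_matrix g C -> C i i = 2.
Proof.
case=> H [a [hv [_ _ _ hcor hC]]].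
have [_ hii] := hcor i; apply/eqP; rewrite -(eqr_int K) -hC hii.
by rewrite -pmulrn.
Qed.

Lemma simply_laced_sym (r : nat) (C : 'M[int]_r) (i j : 'I_r) :
  simply_laced C -> C i j = C j i.
Proof.
by have [->|ij] := eqVneq i j => // /(_ i j ij) [] [-> ->].
Qed.

Section Positivity.
Context {K : numFieldType} {r : nat} {C : 'M[int]_r}.
Context {Q : 'I_r -> int -> Qfield K r}.
Hypothesis hQ : Qsystem C Q.

Lemma Qpos_Qrhs (u : 'I_r -> Qfield K r) (a : 'I_r) :
  (forall b, Qpos (u b)) -> Qpos (Qrhs C u a).
Proof.
move=> hu; apply: QposD; first exact: QposM.
by elim/big_ind: _ => //; [exact: Qpos1 | exact: QposM].
Qed.

(** Induction on [k] in both directions, carrying two consecutive levels: each relation gives the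
    next level as a positive right-hand side divided by a positive known neighbour. *)
Lemma Qsystem_pos (k : int) (a : 'I_r) : Qpos (Q a k).
Proof.
have [Q0 Q1 QS] := hQ.
suff pos2 : (forall b, Qpos (Q b k)) /\ (forall b, Qpos (Q b (k + 1))).
  exact: pos2.1.
have divp (x y z : Qfield K r) : x * y = z -> Qpos y -> Qpos z -> Qpos x.
  move=> xy py pz; have -> : x = z / y by rewrite -xy mulfK // Qpos_neq0.
  exact: QposM pz (QposV py).
elim/int_rect: k => [|n [p0 p1]|n [p0 p1]].
- by split=> b; [rewrite Q0 | rewrite add0r Q1]; apply: QposX.
- have e : Posz n.+1 = Posz n + 1 by rewrite -PoszD addn1.
  rewrite e; split=> // b.
  apply: (divp _ _ _ (QS b (Posz n + 1))); first by rewrite addrK.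
  exact: (@Qpos_Qrhs (fun c => Q c (Posz n + 1))).
- have e : - Posz n.+1 = - Posz n - 1 by rewrite -addn1 PoszD opprD.
  rewrite e; split=> b; last by rewrite subrK.
  have := QS b (- Posz n); rewrite mulrC => h.
  apply: (divp _ _ _ h) => //.
  exact: (@Qpos_Qrhs (fun c => Q c (- Posz n))).
Qed.

End Positivity.

Section LowerMutations.
Context {F : fieldType} {r : nat} {C : 'M[int]_r} {s : seed F (r + r)}.
Hypothesis exchange_s : exchange s = block_mx 0 (- C) C 0.

Lemma mutate_seq_rcons (ms : seq 'I_(r + r)) (m : 'I_(r + r)) :
  mutate_seq (rcons ms m) s = mutate (mutate_seq ms s) m.
Proof. by rewrite /mutate_seq foldl_rcons. Qed.

(** An arbitrary duplicate-free [l] allows induction by appending one last mutation. *)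
Lemma exchange_mutate_lower (l : seq 'I_r) : uniq l ->
  exchange (mutate_seq [seq rshift r a | a <- l] s) =
  block_mx
    (\matrix_(i, j) \sum_(a <- l) sgz (- C i a) * pospart (- C i a * C a j))
    (\matrix_(i, j) if j \in l then C i j else - C i j)
    (\matrix_(i, j) if i \in l then - C i j else C i j) 0.
Proof.
elim/last_ind: l => [_|l a IH].
  rewrite /= exchange_s; congr block_mx.
  - by apply/matrixP => i j; rewrite !mxE big_nil.
  - by apply/matrixP => i j; rewrite !mxE.
  - by apply/matrixP => i j; rewrite !mxE.
rewrite rcons_uniq map_rcons mutate_seq_rcons => /andP[al ul].
rewrite /= {}IH //; apply/matrixP => i j; rewrite [LHS]mxE.
have inr b : (b \in rcons l a) = (b == a) || (b \in l).
  by rewrite mem_rcons inE.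
have eqrr (b : 'I_r) : (rshift r b == rshift r a) = (b == a).
  exact: (inj_eq (@rshift_inj r r)).
have eqlr (b : 'I_r) : (lshift r b == rshift r a) = false := eq_lrshift _ _.
case: (split_ordP i) => i' ->; case: (split_ordP j) => j' ->;
  rewrite ?eqrr ?eqlr ?block_mxEul ?block_mxEur ?block_mxEdl ?block_mxEdr !mxE
    ?(negPf al) ?inr /=.
(* Since [a] is not in [l], its row and column still have their initial off-diagonal entries, which
   produce exactly the summand at [a]. *)
- by rewrite -cats1 big_cat big_seq1.
(* In the other three blocks the correction has a factor from the zero lower right block, so only
   the sign change at [a] remains. *)
- by have [->|] := eqVneq j' a;
    rewrite ?(negPf al) ?opprK //= /pospart mulr0 maxxx mulr0 addr0.
- by have [->|] := eqVneq i' a; rewrite ?(negPf al) //= sgz0 mul0r addr0.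
- by case: ifP; rewrite ?oppr0 // sgz0 mul0r addr0.
Qed.

Lemma cluster_mutate_lower (u v : 'rV[F]_r) (l : seq 'I_r) :
  cluster s = row_mx u v -> uniq l ->
  cluster (mutate_seq [seq rshift r a | a <- l] s) =
  row_mx u (\row_a if a \in l then
      (v 0 a)^-1 * (\prod_j u 0 j ^ pospart (- C j a)
                    + \prod_j u 0 j ^ pospart (C j a))
    else v 0 a).
Proof.
move=> cluster_s; elim/last_ind: l => [_|l a IH].
  by rewrite /= cluster_s; congr row_mx; apply/rowP => i; rewrite !mxE.
rewrite rcons_uniq map_rcons mutate_seq_rcons => /andP[al ul].
rewrite /= {}IH // exchange_mutate_lower //; apply/rowP => i; rewrite [LHS]mxE.
case: (split_ordP i) => i' ->; first by rewrite eq_lrshift !row_mxEl.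
rewrite (inj_eq (@rshift_inj r r)) !row_mxEr !mxE mem_rcons inE (negPf al).
have [->|//] := eqVneq i' a; rewrite /=; congr (_ * (_ + _)).
(* The lower variables have exponent 0, so earlier mutations do not affect the exchange relation at
   [a]. *)
all: rewrite big_split_ord /= [X in _ * X]big1 => [|j _];
  last by rewrite block_mxEdr !mxE /pospart ?oppr0 maxxx expr0z.
all: rewrite mulr1; apply: eq_bigr => j _.
all: by rewrite row_mxEl block_mxEur mxE (negPf al) ?opprK.
Qed.

End LowerMutations.

Section SimplyLaced.
Context {r : nat} {C : 'M[int]_r}.
Hypotheses (laced : simply_laced C) (diag2 : forall i, C i i = 2).

(** For [a] distinct from [i] and [j], both entries are 0 or -1, so the argument of [pospart] is at
    most 0. If [i = j], the term at [i] has argument -4. Otherwise the terms at [i] and [j] are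
    opposite. *)
Lemma simply_laced_corrections_cancel (i j : 'I_r) :
  \sum_a sgz (- C i a) * pospart (- C i a * C a j) = 0.
Proof.
have vanish a : a != i -> a != j ->
    sgz (- C i a) * pospart (- C i a * C a j) = 0.
  move=> ai aj; rewrite eq_sym in ai.
  by case: (laced _ _ ai) => -[-> _]; case: (laced _ _ aj) => -[-> _].
have [ji|ij] := eqVneq i j.
  subst j; rewrite (bigD1 i) //= diag2 big1 => [//|a ai]; exact: vanish.
rewrite (bigD1 i) //= (bigD1 j) 1?eq_sym //= big1 => [|a /andP[ai aj]];
  last exact: vanish.
by rewrite !diag2; case: (laced _ _ ij) => -[-> _].
Qed.

(** The exponent is 1 at the neighbours of [a] and 0 elsewhere, including at [a], where the entry of
    [- C] is -2. *)
Lemma prod_pospart_neg (F : fieldType) (u : 'I_r -> F) (a : 'I_r) :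
  \prod_j u j ^ pospart (- C j a) = \prod_(b | dynkin_adj C b a) u b.
Proof.
rewrite [RHS]big_mkcond; apply: eq_bigr => j _; rewrite /dynkin_adj /=.
have [->|ja] := eqVneq j a; first by rewrite diag2.
by case: (laced _ _ ja) => -[-> _].
Qed.

(** The only positive entry in column [a] of [C] is the diagonal 2. *)
Lemma prod_pospart (F : fieldType) (u : 'I_r -> F) (a : 'I_r) :
  \prod_j u j ^ pospart (C j a) = u a ^+ 2.
Proof.
rewrite (bigD1 a) //= diag2 big1 ?mulr1 // => j ja.
by case: (laced _ _ ja) => -[-> _].
Qed.

End SimplyLaced.

Theorem lemma3p8 (R : realType) (g : lieAlgebra R[i]) (r : nat) (C : 'M[int]_r)
    (Q : 'I_r -> int -> Qfield R[i] r) (k : int)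
    (s : seed (Qfield R[i] r) (r + r)) :
  lie_simple g -> cartan_matrix g C -> simply_laced C ->
  Qsystem C Q ->
  cluster s = row_mx (\row_a Q a (2 * k)) (\row_a Q a (2 * k + 1)) ->
  exchange s = block_mx 0 (- C) C 0 ->
  let s' := mutate_seq [seq rshift r a | a <- enum 'I_r] s in
  cluster s' = row_mx (\row_a Q a (2 * k)) (\row_a Q a (2 * k - 1)) /\
  exchange s' = block_mx 0 C (- C) 0.
Proof.
move=> _ cartan laced hQ hx hB s'.
have diag2 i : C i i = 2 := cartan_matrix_diag _ _ _ _ i cartan.
have uI : uniq (enum 'I_r) by rewrite enum_uniq.
split.
  rewrite (cluster_mutate_lower hB _ _ _ hx uI); congr row_mx.
  apply/rowP => a; rewrite !mxE mem_enum inE /=.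
  have nz : Q a (2 * k + 1) != 0 := Qpos_neq0 (Qsystem_pos hQ _ _).
  (* Multiplying by [Q a (2 * k + 1)] turns the claim into the Q-system relation at level
     [2 * k]. *)
  apply: (mulfI nz); rewrite mulVKf //.
  under eq_bigr do rewrite mxE.
  under [X in _ + X]eq_bigr do rewrite mxE.
  rewrite (prod_pospart_neg laced diag2) (prod_pospart laced diag2) addrC.
  by case: hQ => _ _ ->.
(* Every node is listed, so both off-diagonal blocks change sign and the upper left sum runs over
   all nodes. *)
rewrite (exchange_mutate_lower hB _ uI); congr block_mx;
  apply/matrixP => i j; rewrite !mxE ?mem_enum //.
by rewrite big_enum simply_laced_corrections_cancel.
Qed.
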